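(* Let $n, k_{\mathrm{in}}, k_{\mathrm{out}}\geq 1$ be integers, let $N_{\mathrm{in}}=\binom{n+k_{\mathrm{in}}}{n}$ and $N_{\mathrm{out}}=\binom{n+k_{\mathrm{out}}}{n}$, and let $\mathcal{A}=C^\infty(\mathbb{R}^n)$. Let $\square_{k_{\mathrm{in}}}\in\mathrm{Hom}_{\mathbb{R}}(\bigwedge^{N_{\mathrm{in}}}\mathcal{A},\mathcal{A})$ and $\square_{k_{\mathrm{out}}}\in\mathrm{Hom}_{\mathbb{R}}(\bigwedge^{N_{\mathrm{out}}}\mathcal{A},\mathcal{A})$ be the multidimensional Wronskian brackets of orders $k_{\mathrm{in}}$ and $k_{\mathrm{out}}$, respectively. Then $$\square_{k_{\mathrm{out}}}[\square_{k_{\mathrm{in}}}]=0 .$$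
   Context: For a multi-index $\sigma=(\sigma^1,\dots,\sigma^n)\in\mathbb{Z}_{\geq0}^n$ put $|\sigma|=\sigma^1+\dots+\sigma^n$ and $D_\sigma=\partial^{|\sigma|}/\partial (x^1)^{\sigma^1}\cdots\partial (x^n)^{\sigma^n}$, acting on $\mathcal{A}=C^\infty(\mathbb{R}^n)$. For an integer $k\geq1$ there are exactly $N=\binom{n+k}{n}$ multi-indices $\sigma$ with $0\leq|\sigma|\leq k$; fix an enumeration $\sigma_1,\dots,\sigma_N$ of them with $|\sigma_i|$ non-decreasing. The multidimensional Wronskian bracket of order $k$ is the $N$-linear skew-symmetric map $$\square_k(a_1,\dots,a_N)=\det\|D_{\sigma_i}(a_j)\|_{1\leq i,j\leq N},\qquad a_j\in\mathcal{A}.$$ (A different ordering of the multi-indices changes $\square_k$ only by a sign.) For $\Delta\in\mathrm{Hom}(\bigwedge^k\mathcal{A},\mathcal{A})$ and $\nabla\in\mathrm{Hom}(\bigwedge^l\mathcal{A},\mathcal{A})$ (skew-symmetric multilinear maps), the action $\Delta[\nabla]\in\mathrm{Hom}(\bigwedge^{k+l-1}\mathcal{A},\mathcal{A})$ is $$\Delta[\nabla](a_1,\dots,a_{k+l-1})=\sum_{\sigma\in S^l_{k+l-1}}(-1)^\sigma\,\Delta\bigl(\nabla(a_{\sigma(1)},\dots,a_{\sigma(l)}),a_{\sigma(l+1)},\dots,a_{\sigma(k+l-1)}\bigr),$$ where $S^l_m\subset S_m$ is the set of unshuffles, i.e. permutations with $\sigma(1)<\dots<\sigma(l)$ and $\sigma(l+1)<\dots<\sigma(m)$,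 and $(-1)^\sigma$ is the sign of $\sigma$. *)

(* Defs.v *)
From HB Require Import structures.
From mathcomp Require Import all_boot all_order all_algebra all_fingroup.
From mathcomp Require Import all_classical all_reals all_analysis.

Set Implicit Arguments.
Unset Strict Implicit.
Unset Printing Implicit Defensive.

Import Order.TTheory GRing.Theory Num.Theory numFieldNormedType.Exports.

Local Open Scope ring_scope.

Section Smooth.
Variables (R : realType) (n : nat).
Implicit Types (f g : 'rV[R]_n -> R) (s : seq 'I_n).

Definition partial (i : 'I_n) f : 'rV[R]_n -> R :=
  fun x => 'D_(delta_mx 0 i) f x.

Definition iter_partial s f : 'rV[R]_n -> R := foldr partial f s.

(* [derive] is total, so the existence of each next partial derivative has to
   be required explicitly. *)
Definition smooth f : Prop :=
  forall s, continuous (iter_partial s f) /\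
    (forall i x, derivable (iter_partial s f) x (delta_mx 0 i)).

Lemma smooth_partial i f : smooth f -> smooth (partial i f).
Proof.
by move=> sf s; have := sf (rcons s i); rewrite /iter_partial foldr_rcons.
Qed.

Lemma smooth_continuous f : smooth f -> continuous f.
Proof. by move=> /(_ [::])[]. Qed.

Lemma smooth_derivable f i x : smooth f -> derivable f x (delta_mx 0 i).
Proof. by move=> /(_ [::])[]. Qed.

(* Coinduction principle: a class of continuous, partially differentiable
   functions that is stable under partial derivatives consists of smooth
   functions. *)
Lemma smooth_coind (P : ('rV[R]_n -> R) -> Prop) :
  (forall f, P f -> continuous f) ->
  (forall f i x, P f -> derivable f x (delta_mx 0 i)) ->
  (forall f i, P f -> P (partial i f)) ->
  forall f, P f -> smooth f.
Proof.
move=> Pc Pd Pp f Pf s; have Ps : P (iter_partial s f).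
  by elim: s => //= i s; apply: Pp.
by split; [exact: Pc|move=> i x; exact: Pd].
Qed.

Lemma partialB i f g : smooth f -> smooth g ->
  partial i (f - g) = partial i f - partial i g.
Proof.
move=> sf sg; apply/funext => x; rewrite /partial deriveB //;
  exact: smooth_derivable.
Qed.

Lemma partialD i f g : smooth f -> smooth g ->
  partial i (f + g) = partial i f + partial i g.
Proof.
move=> sf sg; apply/funext => x; rewrite /partial deriveD //;
  exact: smooth_derivable.
Qed.

Lemma partialM i f g : smooth f -> smooth g ->
  partial i (f * g) = partial i f * g + f * partial i g.
Proof.
move=> sf sg; apply/funext => x; rewrite /partial deriveM;
  [|exact: smooth_derivable..].
by rewrite addrC mulrC.
Qed.

Lemma partialZ i (c : R) f : smooth f ->
  partial i (c *: f) = c *: partial i f.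
Proof.
move=> sf; apply/funext => x; rewrite /partial deriveZ //;
  exact: smooth_derivable.
Qed.

Lemma partial_cst i (c : R) : partial i (cst c) = cst 0.
Proof. by apply/funext => x; rewrite /partial derive_cst. Qed.

Lemma smooth_cst (c : R) : smooth (cst c).
Proof.
apply: (@smooth_coind (fun f => exists c, f = cst c)); last by exists c.
- by move=> _ [d ->]; exact: cst_continuous.
- by move=> _ i x [d ->]; exact: derivable_cst.
- by move=> _ i [d ->]; exists 0; rewrite partial_cst.
Qed.

Lemma smoothZ (c : R) f : smooth f -> smooth (c *: f).
Proof.
move=> sf; apply: (@smooth_coind (fun h => exists2 f, smooth f & h = c *: f)).
- move=> _ [h sh ->] x; apply: continuousZr; exact: smooth_continuous.
- move=> _ i x [h sh ->]; apply: derivableZ; exact: smooth_derivable.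
- move=> _ i [h sh ->]; exists (partial i h); first exact: smooth_partial.
  exact: partialZ.
- by exists f.
Qed.

Lemma smoothD f g : smooth f -> smooth g -> smooth (f + g).
Proof.
move=> sf sg; apply: (@smooth_coind
  (fun h => exists u v, [/\ smooth u, smooth v & h = u + v])).
- move=> _ [u [v [su sv ->]]] x.
  by apply: continuousD; exact: smooth_continuous.
- move=> _ i x [u [v [su sv ->]]]; apply: derivableD; exact: smooth_derivable.
- move=> _ i [u [v [su sv ->]]]; exists (partial i u), (partial i v).
  by split; [exact: smooth_partial..|exact: partialD].
- by exists f, g.
Qed.

Lemma smoothB f g : smooth f -> smooth g -> smooth (f - g).
Proof.
by move=> sf sg; rewrite -scaleN1r; apply: smoothD => //; exact: smoothZ.
Qed.

(* Finite sums of products of two smooth functions. *)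
Inductive sum_prod : ('rV[R]_n -> R) -> Prop :=
| SumProd0 : sum_prod (cst 0)
| SumProdD u v h of smooth u & smooth v & sum_prod h : sum_prod (u * v + h).

Lemma sum_prod_derivable f i x : sum_prod f -> derivable f x (delta_mx 0 i).
Proof.
elim=> [|u v h su sv _ dh]; first exact: derivable_cst.
apply: derivableD; last exact: dh.
by apply: derivableM; exact: smooth_derivable.
Qed.

Lemma smoothM f g : smooth f -> smooth g -> smooth (f * g).
Proof.
move=> sf sg; apply: (@smooth_coind sum_prod).
- move=> h; elim=> {h} [|u v h su sv _ ch] x; first exact: cst_continuous.
  apply: continuousD; last exact: ch.
  by apply: continuousM; exact: smooth_continuous.
- by move=> h i x; exact: sum_prod_derivable.
- move=> h i; elim=> {h} [|u v h su sv sph IH].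
    by rewrite partial_cst; exact: SumProd0.
  have -> : partial i (u * v + h) =
      partial i u * v + (u * partial i v + partial i h).
    rewrite addrA -partialM //; apply/funext => x; rewrite /partial.
    rewrite deriveD //; last exact: sum_prod_derivable.
    by apply: derivableM; exact: smooth_derivable.
  apply: SumProdD; [exact: smooth_partial|exact: sv|].
  by apply: SumProdD; [exact: su|exact: smooth_partial|exact: IH].
- have -> : f * g = f * g + cst 0 by rewrite [cst 0](_ : _ = 0) ?addr0.
  by apply: SumProdD; [exact: sf|exact: sg|exact: SumProd0].
Qed.

Definition smooth_pred : {pred 'rV[R]_n -> R} := fun f => `[< smooth f >].

Lemma smooth_predP f : reflect (smooth f) (f \in smooth_pred).
Proof. exact: asboolP. Qed.

Lemma smooth_subring_closed : subring_closed smooth_pred.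
Proof.
split.
- by apply/smooth_predP; exact: smooth_cst.
- by move=> f g /smooth_predP sf /smooth_predP sg; apply/smooth_predP/smoothB.
- by move=> f g /smooth_predP sf /smooth_predP sg; apply/smooth_predP/smoothM.
Qed.

Lemma smooth_submod_closed : submod_closed smooth_pred.
Proof.
split; first by apply/smooth_predP; exact: smooth_cst.
move=> c f g /smooth_predP sf /smooth_predP sg; apply/smooth_predP.
by apply: smoothD => //; exact: smoothZ.
Qed.

HB.instance Definition _ := GRing.isSubringClosed.Build ('rV[R]_n -> R)
  smooth_pred smooth_subring_closed.
HB.instance Definition _ := GRing.isSubmodClosed.Build R ('rV[R]_n -> R)
  smooth_pred smooth_submod_closed.

(* C^oo(R^n) *)
Record smoothFun := SmoothFun {
  smooth_fun :> 'rV[R]_n -> R;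
  smooth_funP : smooth_fun \in smooth_pred }.

HB.instance Definition _ := [isSub for smooth_fun].
HB.instance Definition _ := [Choice of smoothFun by <:].
HB.instance Definition _ := [SubChoice_isSubComNzRing of smoothFun by <:].
HB.instance Definition _ := [SubZmodule_isSubLmodule of smoothFun by <:].

Lemma smooth_partial_pred i (f : smoothFun) : partial i f \in smooth_pred.
Proof.
by apply/smooth_predP/smooth_partial/smooth_predP; exact: smooth_funP.
Qed.

Definition D (i : 'I_n) (f : smoothFun) : smoothFun :=
  SmoothFun (smooth_partial_pred i f).

Definition multiindex := {ffun 'I_n -> nat}.

Definition mnorm (sigma : multiindex) : nat := (\sum_i sigma i)%N.

(* For smooth f the order in which the partial derivatives are taken is
   immaterial; here the last variable is differentiated first. *)
Definition Dm (sigma : multiindex) (f : smoothFun) : smoothFun :=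
  foldr (fun i => iter (sigma i) (D i)) f (enum 'I_n).

Definition graded_enum (k N : nat) (s : 'I_N -> multiindex) : Prop :=
  [/\ injective s,
      forall sigma, (mnorm sigma <= k)%N <-> exists i, s i = sigma
    & forall i j : 'I_N, (i <= j)%N -> (mnorm (s i) <= mnorm (s j))%N].

Definition wronskian (N : nat) (s : 'I_N -> multiindex) (a : 'I_N -> smoothFun)
    : smoothFun :=
  \det (\matrix_(i, j) Dm (s i) (a j)).

Lemma D_linear i : linear (D i).
Proof.
move=> c f g; apply: val_inj => /=.
have sf : smooth f by apply/smooth_predP; exact: smooth_funP.
have sg : smooth g by apply/smooth_predP; exact: smooth_funP.
by rewrite -partialZ // -partialD //; exact: smoothZ.
Qed.

Lemma Dm_linear sigma : linear (Dm sigma).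
Proof.
move=> c f g; rewrite /Dm; elim: (enum 'I_n) => //= i r ->.
by elim: (sigma i) => //= m ->; exact: D_linear.
Qed.

(* Hom(/\^N C^oo(R^n), C^oo(R^n)) *)
Definition skew_multilinear (N : nat)
    (F : ('I_N -> smoothFun) -> smoothFun) : Prop :=
  (forall (a : 'I_N -> smoothFun) i, linear (fun f : smoothFun => F (dfwith a i f))) /\
  (forall (a : 'I_N -> smoothFun) (s : 'S_N), F (a \o s) = (-1) ^+ s * F a).

Lemma smooth_scaleE (c : R) (f : smoothFun) : c *: f = (c *: (1 : smoothFun)) * f.
Proof.
apply: val_inj; apply/funext => x /=.
by rewrite -[RHS]/(c * 1 * f x) mulr1.
Qed.

Lemma wronskian_skew_multilinear (N : nat) (s : 'I_N -> multiindex) :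
  skew_multilinear (wronskian s).
Proof.
have wT a : wronskian s a = \det (\matrix_(j, i) Dm (s i) (a j)).
  by rewrite /wronskian -det_tr; congr (\det _); apply/matrixP => i j; rewrite !mxE.
split=> [a j c f g|a p]; rewrite !wT.
  rewrite [in RHS]smooth_scaleE -[X in _ = _ + X]mul1r.
  apply: (determinant_multilinear (i0 := j)).
  - apply/rowP => i; rewrite !mxE !dfwithin Dm_linear.
    by rewrite mul1r; congr (_ + _); exact: smooth_scaleE.
  - by apply/(@matrixP smoothFun) => k i; rewrite !mxE !dfwithout // neq_lift.
  - by apply/(@matrixP smoothFun) => k i; rewrite !mxE !dfwithout // neq_lift.
rewrite -det_perm -det_mulmx -row_permE; congr (\det _).
by apply/matrixP => i j; rewrite !mxE.
Qed.
End Smooth.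

(* The hypothesis [graded_enum] on a family indexed by 'I_('C(n + k, n)) is
   satisfiable. *)
Lemma graded_enum_exists (n k : nat) :
  exists s : 'I_('C(n + k, n)) -> multiindex n, graded_enum k s.
Proof.
pose T := [set t : n.-tuple 'I_k.+1 | (\sum_(i <- t) i <= k)%N].
pose m (t : n.-tuple 'I_k.+1) : multiindex n := [ffun i => nat_of_ord (tnth t i)].
have mE t : mnorm (m t) = (\sum_(i <- t) i)%N.
  by rewrite /mnorm big_tuple; apply: eq_bigr => i _; rewrite ffunE.
have m_inj : injective m.
  move=> t u /ffunP tu; apply: eq_from_tnth => i; apply: val_inj.
  by have := tu i; rewrite !ffunE.
pose le (s t : multiindex n) := (mnorm s <= mnorm t)%N.
pose l := sort le [seq m t | t <- enum T].
have lu : uniq l by rewrite sort_uniq (map_inj_uniq m_inj) enum_uniq.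
have sl : size l = 'C(n + k, n).
  by rewrite size_sort size_map -cardE card_partial_ord_partitions.
have le_tr : transitive le by move=> x y z; exact: leq_trans.
have ls : sorted le l by apply: sort_sorted => x y; exact: leq_total.
have lP sigma : (sigma \in l) = (mnorm sigma <= k)%N.
  rewrite mem_sort; apply/mapP/idP => [[t + ->]|hs].
    by rewrite mem_enum inE mE.
  have lt i : (sigma i < k.+1)%N.
    by rewrite ltnS (leq_trans _ hs) // /mnorm (bigD1 i) //= leq_addr.
  have Em : sigma = m [tuple Ordinal (lt i) | i < n].
    by apply/ffunP => i; rewrite ffunE tnth_mktuple.
  by exists [tuple Ordinal (lt i) | i < n]; rewrite // mem_enum inE -mE -Em.
exists (fun i => nth [ffun=> 0%N] l i); split.
- move=> i j /eqP; rewrite nth_uniq ?sl ?ltn_ord // => /eqP; exact: val_inj.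
- move=> sigma; rewrite -lP; split.
    move=> hs; have hi : (index sigma l < 'C(n + k, n))%N.
      by rewrite -sl index_mem.
    by exists (Ordinal hi); rewrite /= nth_index.
  by move=> [i <-]; rewrite mem_nth // sl.
- move=> i j ij; apply: (sorted_leq_nth le_tr) => //; rewrite ?inE ?sl //.
  by move=> x; rewrite /le.
Qed.

Section Action.
Variable A : nzRingType.

Definition unshuffle (l m : nat) (s : 'S_m) : bool :=
  [forall p : 'I_m, forall q : 'I_m,
    (p < q)%N && ((q < l)%N || (l <= p)%N) ==> (s p < s q)%N].

(* Positions are numbered from 0: the first l of them, [lshift k' _], are fed to
   Nabla, the remaining k' ones, [rshift l _], go to slots 1, ..., k' of Delta.
   The clause k = 0 is a convention; there is then no slot to insert into. *)
Definition bracket_action (k l : nat) :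
    (('I_k -> A) -> A) -> (('I_l -> A) -> A) -> ('I_(k + l).-1 -> A) -> A :=
  match k with
  | 0 => fun _ _ _ => 0
  | k'.+1 => fun Delta Nabla a =>
    \sum_(s : 'S_(k' + l) | unshuffle l s) (-1) ^+ s *
      Delta (fun i : 'I_k'.+1 =>
        if unlift ord0 i is Some j
        then a (s (cast_ord (addnC l k') (rshift l j)))
        else Nabla (fun j : 'I_l => a (s (cast_ord (addnC l k') (lshift k' j)))))
  end.

End Action.

(* Main.v *)
Require Import Defs.
From HB Require Import structures.
From mathcomp Require Import all_boot all_order all_algebra all_fingroup.
From mathcomp Require Import all_classical all_reals all_analysis.
From mathcomp Require Import zify.

(** The identity holds for reasons of degree. Give a monomial
    D_(tau_1)(a_1) ... D_(tau_M)(a_M) in the derivatives of M arguments the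
    weight |tau_1| + ... + |tau_M|. The bracket of order k is homogeneous of
    weight T_k, the sum of |sigma| over all sigma with |sigma| <= k, and
    inserting one homogeneous operator into another adds the weights, by the
    Leibniz rule. Thus the expression
      G(a) = W_out(W_in(a_1, ..., a_l), a_(l+1), ..., a_M)
    has weight T_in + T_out, and it has M = N_out + N_in - 1 arguments.

    Because both Wronskians are skew-symmetric, the sum over unshuffles is, up
    to the factor l! (M - l)!, the alternation of G over all permutations of
    the M arguments ([sum_unshuffle], [alternation_insertion]). The alternation
    of a monomial is the determinant of the D_(tau_i)(a_j), which vanishes
    unless the tau_i are pairwise distinct. But M distinct multi-indices weigh
    more than T_in + T_out: if k is the larger of the two orders, they weigh at
    least as much as the N_k multi-indices of norm at most k together with
    M - N_k = N' - 1 more of norm k + 1 ([degree_sum_ge]), where k' <= k is the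
    other order and N' = N_(k'), whereas
    T_(k') <= (N' - 1) k' < (N' - 1)(k + 1), one of the N' multi-indices being 0
    ([degree_sum_le]). So every monomial of the alternation is zero
    ([alternation_jet_form]).

    Collecting iterated derivatives into multi-indices needs the symmetry of
    second derivatives ([derive_comm]); without it there would be too many
    symbols of low weight and the count would fail. *)

Set Implicit Arguments.
Unset Strict Implicit.
Unset Printing Implicit Defensive.

Import Order.TTheory GRing.Theory Num.Theory numFieldNormedType.Exports.

Local Open Scope ring_scope.

(** * Symmetry of second derivatives *)

Section Schwarz.
Variables (R : realType) (V : normedModType R).
Implicit Types (f : V -> R) (x u v : V).

Lemma is_derive_line f x v (t : R) : derivable f (x + t *: v) v ->
  is_derive t 1 (fun s : R => f (x + s *: v)) ('D_v f (x + t *: v)).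
Proof.
have lineE : (fun h : R => h^-1 *: (((fun s : R => f (x + s *: v)) \o shift t)
      (h *: 1) - f (x + t *: v))) =
    (fun h : R => h^-1 *: ((f \o shift (x + t *: v)) (h *: v) - f (x + t *: v))).
  apply/funext => h /=; congr (_ *: (f _ - _)).
  by rewrite addrCA -scalerDl [h *: 1]mulr1.
move=> df; split; first by rewrite /derivable lineE.
by rewrite /derive lineE.
Qed.

Lemma MVT_line f x v (h : R) : 0 < h -> (forall y, derivable f y v) ->
  exists2 t : R, 0 < t < h & f (x + h *: v) - f x = 'D_v f (x + t *: v) * h.
Proof.
move=> h0 df.
have dg t : is_derive t (1 : R) (fun s : R => f (x + s *: v))
    ('D_v f (x + t *: v)) by exact: is_derive_line.
have [|t] := @MVT R _ _ 0 h h0 (fun t _ => dg t).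
  by apply: derivable_within_continuous => t _; case: (dg t).
by rewrite in_itv /= scale0r addr0 subr0; exists t.
Qed.

(** Two applications of the mean value theorem: to y |-> f (y + h v) - f y in
    the direction u, then to 'D_u f in the direction v. *)
Lemma second_difference f x u v (h : R) : 0 < h ->
    (forall y, derivable f y u) -> (forall y, derivable ('D_u f) y v) ->
  exists s t : R, [/\ 0 < s < h, 0 < t < h &
    f (x + h *: v + h *: u) - f (x + h *: v) - (f (x + h *: u) - f x) =
    'D_v ('D_u f) (x + s *: u + t *: v) * h * h].
Proof.
move=> h0 df ddf.
pose g y := f (y + h *: v) - f y.
have shift_der y : derivable (fun z => f (z + h *: v)) y u /\
    'D_u (fun z => f (z + h *: v)) y = 'D_u f (y + h *: v).
  have E : (fun k : R => k^-1 *: (((fun z => f (z + h *: v)) \o shift y)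
        (k *: u) - f (y + h *: v))) =
      (fun k : R => k^-1 *: ((f \o shift (y + h *: v)) (k *: u) - f (y + h *: v))).
    by apply/funext => k /=; rewrite addrA.
  by split; rewrite ?/derivable ?/derive E //; exact: df.
have dg y : derivable g y u.
  by apply: derivableB; [have [] := shift_der y|exact: df].
have [s sh gs] := MVT_line x h0 dg.
have [t th ft] := MVT_line (x + s *: u) h0 ddf.
exists s, t; split => //.
rewrite -ft; move: gs; rewrite /g deriveB; [|by have [] := shift_der (x + s *: u)|exact: df].
rewrite (shift_der _).2 => <-.
rewrite (addrAC x (h *: u)) !opprD !opprK !addrA; congr (_ + _).
exact: addrAC.
Qed.

(** The second difference of f is symmetric in u
    and v, so each mixed derivative takes, at a point as close to x as desired,
    a value common to both; continuity transports the equality to x. *)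
Lemma derive_comm f u v :
    (forall x, derivable f x u) -> (forall x, derivable f x v) ->
    (forall x, derivable ('D_u f) x v) -> (forall x, derivable ('D_v f) x u) ->
    continuous ('D_v ('D_u f)) -> continuous ('D_u ('D_v f)) ->
  'D_v ('D_u f) = 'D_u ('D_v f).
Proof.
move=> fu fv fuv fvu cuv cvu; apply/funext => x.
apply/eqP; rewrite -subr_eq0 -normr_le0; apply/ler_addgt0Pl => e e0; rewrite addr0.
pose line (p : R * R) := x + p.1 *: u + p.2 *: v.
have line0 : line (0, 0) = x by rewrite /line !scale0r !addr0.
have cline : continuous line.
  move=> p; rewrite /line; apply: cvgD; last by apply: cvgZr_tmp; exact: cvg_snd.
  by apply: cvgD; [exact: cvg_cst|apply: cvgZr_tmp; exact: cvg_fst].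
have near_line (F : V -> R) : continuous F -> exists2 d : R, 0 < d &
    forall s t : R, 0 < s < d -> 0 < t < d -> `|F x - F (line (s, t))| < e / 2.
  move=> cF; have cFl : continuous (F \o line).
    by move=> p; apply: continuous_comp; [exact: cline|exact: cF].
  have /cvgrPdist_lt/(_ _ (divr_gt0 e0 (ltr0Sn R 1))) := cFl (0, 0).
  move=> /nbhs_ballP[d /= d0 dP]; exists d => // s t /andP[s0 sd] /andP[t0 td].
  by rewrite -{1}line0; apply: dP; split; rewrite /= /ball /= sub0r normrN gtr0_norm.
have [d d0 dP] := near_line _ cuv.
have [d' d'0 d'P] := near_line _ cvu.
pose h := Num.min d d'.
have h0 : 0 < h by rewrite lt_min d0.
have [s [t [sh th E]]] := second_difference x h0 fu fuv.
have [s' [t' [sh' th' E']]] := second_difference x h0 fv fvu.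
have lth r : 0 < r < h -> (0 < r < d) /\ (0 < r < d').
  by move=> /andP[-> /=]; rewrite lt_min => /andP.
have eqF : 'D_v ('D_u f) (line (s, t)) = 'D_u ('D_v f) (line (t', s')).
  have cancel_h : injective (fun z : R => z * h * h).
    by move=> z z' /(mulIf (lt0r_neq0 h0))/(mulIf (lt0r_neq0 h0)).
  apply: cancel_h; apply: etrans (esym E) _.
  rewrite [line (t', s')](_ : _ = x + s' *: v + t' *: u); last by rewrite /line addrAC.
  rewrite -E' (addrAC x (h *: v)) !opprD !opprK !addrA; congr (_ + _).
  exact: addrAC.
have [sd _] := lth _ sh; have [td _] := lth _ th.
have [_ sd'] := lth _ sh'; have [_ td'] := lth _ th'.
rewrite -(subrKA ('D_v ('D_u f) (line (s, t)))) [e]splitr.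
apply: (le_trans (ler_normD _ _)); apply: lerD; first exact/ltW/dP.
by rewrite eqF distrC; apply/ltW/d'P.
Qed.

End Schwarz.

(** * Unshuffles as coset representatives *)

Section Young.
Variables (l m : nat).
Implicit Types (h s u : 'S_m) (p q : 'I_m).

Definition same_block p q := (p < l)%N == (q < l)%N.

(** The Young subgroup S_l x S_(m - l), presented by transpositions: a function
    that changes sign under each of them is then skew under the whole subgroup,
    with no need to compute signs of permutations assembled from two blocks. *)
Definition young : {group 'S_m} :=
  <<[set tperm pq.1 pq.2 | pq : 'I_m * 'I_m & same_block pq.1 pq.2]>>%G.

Lemma unshuffleP u : reflect
  (forall p q, (p < q)%N -> same_block p q -> (u p < u q)%N) (unshuffle l u).
Proof.
apply: (iffP forallP) => [H p q pq|H p].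
  have /forallP/(_ q)/implyP := H p; rewrite pq /= /same_block => Hpq bpq.
  by apply: Hpq; lia.
apply/forallP => q; apply/implyP => /andP[pq b]; apply: H => //.
by rewrite /same_block; lia.
Qed.

Lemma young_tperm p q : same_block p q -> tperm p q \in young.
Proof.
by move=> b; apply: mem_gen; apply/imsetP; exists (p, q); rewrite ?inE.
Qed.

Lemma young_ind (P : pred 'S_m) :
  P 1%g -> (forall g h, P g -> P h -> P (g * h)%g) ->
  (forall p q, same_block p q -> P (tperm p q)) ->
  forall h, h \in young -> P h.
Proof.
move=> P1 PM Pt h hh.
have gP : group_set [set h | P h].
  apply/group_setP; split=> [|x y]; rewrite ?inE //; exact: PM.
suff /fintype.subsetP/(_ _ hh) : young \subset Group gP by rewrite inE.
rewrite gen_subG; apply/fintype.subsetP => _ /imsetP[[p q] b ->].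
  by rewrite inE /= in b; rewrite inE; exact: Pt.
Qed.

Lemma young_block h p : h \in young -> same_block (h p) p.
Proof.
move=> hh; move: p; apply/forallP; move: h hh; apply: young_ind.
- by apply/forallP => p; rewrite perm1 /same_block.
- move=> g h /forallP Pg /forallP Ph; apply/forallP => p; rewrite permM.
  by rewrite /same_block (eqP (Ph _)) (eqP (Pg _)).
- move=> p q b; apply/forallP => r; rewrite /same_block in b *.
  by case: tpermP => [->|->|_ _]; rewrite ?(eqP b) eqxx.
Qed.

Lemma increasing_perm1 h : {homo h : p q / (p < q)%N} -> h = 1%g.
Proof.
(* An increasing map never lies below the identity; this is applied to h and to
   its inverse. *)
have le_incr (g : 'S_m) : {homo g : p q / (p < q)%N} ->
    forall k (p : 'I_m), (p = k :> nat) -> (k <= g p)%N.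
  move=> hg; elim=> // k IH p pk.
  have k_lt : (k < m)%N by rewrite ltnW // -pk.
  apply: leq_ltn_trans (IH (Ordinal k_lt) erefl) _.
  by apply: hg; rewrite /= pk.
move=> hh; apply/permP => p; apply: val_inj; rewrite perm1 /=.
apply/anti_leq; rewrite (le_incr _ hh _ p erefl) andbT.
suff hV : {homo h^-1%g : p q / (p < q)%N}.
  by have := le_incr _ hV _ (h p) erefl; rewrite permK.
move=> a b ab; rewrite ltnNge; apply/negP; rewrite leq_eqVlt => /orP[/eqP E|/hh].
  by move: ab; rewrite -(perm_inj (val_inj E)) ltnn.
by rewrite !permKV; lia.
Qed.

(** Since u and h u are both increasing on each block, so is h; and h preserves
    the blocks, hence it is increasing everywhere. *)
Lemma unshuffle_coset_uniq h u : h \in young -> unshuffle l u ->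
  unshuffle l (h * u)%g -> h = 1%g.
Proof.
move=> hh /unshuffleP us /unshuffleP hus; apply: increasing_perm1 => p q pq.
have /eqP bp := young_block p hh; have /eqP bq := young_block q hh.
have [b|] := boolP (same_block p q); last by rewrite /same_block; lia.
have := hus _ _ pq b; rewrite !permM => lt_u.
rewrite ltnNge; apply/negP; rewrite leq_eqVlt => /orP[/eqP E|qp].
  by rewrite (val_inj E) ltnn in lt_u.
have b' : same_block (h q) (h p) by move: b; rewrite /same_block bp bq eq_sym.
by have := us _ _ qp b'; lia.
Qed.

(** Sorting each block: the sum of p (h s)(p) over p grows whenever an inversion
    inside a block is removed, so its maximum over h in the subgroup is attained
    where no such inversion is left. *)
Lemma unshuffle_coset_exists s : exists2 h, h \in young & unshuffle l (h * s)%g.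
Proof.
pose F h := (\sum_(p < m) p * (h * s)%g p)%N.
pose h := [arg max_(h > (1 : 'S_m)%g | h \in young) F h]%N.
have [hh hmax] : h \in young /\ forall g, g \in young -> (F g <= F h)%N.
  by rewrite /h; case: arg_maxnP; rewrite ?group1.
exists h => //; apply/unshuffleP => p q pq b; rewrite ltnNge; apply/negP => le_qp.
have lt_qp : ((h * s)%g q < (h * s)%g p)%N.
  rewrite ltn_neqAle le_qp andbT; apply/eqP => /val_inj/perm_inj E.
  by rewrite E ltnn in pq.
have := hmax _ (groupM (young_tperm b) hh); rewrite leqNgt => /negP; apply.
have neq_qp : q != p by rewrite -val_eqE /=; lia.
rewrite /F [ltnLHS](bigD1 p) //= [X in (_ + X < _)%N](bigD1 q) //=.
rewrite [ltnRHS](bigD1 p) //= [X in (_ < _ + X)%N](bigD1 q) //= !addnA -!mulgA.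
rewrite (permM _ (h * s)%g p) (permM _ (h * s)%g q) tpermL tpermR.
rewrite [in ltnRHS](eq_bigr (fun i : 'I_m => i * (h * s)%g i)%N); last first.
  by move=> i /andP[ip iq]; rewrite (permM _ (h * s)%g) tpermD // eq_sym.
rewrite ltn_add2r; move: pq lt_qp; clear.
move: (nat_of_ord _) (nat_of_ord _) (nat_of_ord p) (nat_of_ord q).
nia.
Qed.

(** The unshuffles form a transversal of the right cosets of the Young
    subgroup. *)
Lemma sum_unshuffle (V : zmodType) (t : 'S_m -> V) :
  (forall h s, h \in young -> t (h * s)%g = t s) ->
  \sum_s t s = (\sum_(u | unshuffle l u) t u) *+ #|young|.
Proof.
move=> tH.
(* Exactly one unshuffle lies in the coset of s, so the inner sum has a single
   term. *)
have rep s : \sum_(u | unshuffle l u && ((s * u^-1)%g \in young)) t s = t s.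
  have [h hh hs] := unshuffle_coset_exists s.
  rewrite (big_pred1 (h * s)%g) // => u /=; apply/andP/eqP => [[us su]|->].
    have := @unshuffle_coset_uniq (h * s * u^-1)%g u; rewrite mulgKV -mulgA groupM // us hs.
    by move=> /(_ isT isT isT)/eqP; rewrite mulgA -eq_mulgV1 => /eqP.
  by rewrite hs invMg mulKVg groupV.
rewrite -(eq_bigr _ (fun s _ => rep s)) (exchange_big_dep (@unshuffle l m)) /=; last first.
  by move=> s u _ /andP[].
rewrite -sumrMnl; apply: eq_bigr => u us.
rewrite (eq_bigl (fun s => (s * u^-1)%g \in young)) => [|s]; last by rewrite us.
rewrite (reindex_inj (mulIg u)) /= (eq_bigl [in young]) => [|h]; last by rewrite mulgK.
by rewrite -sumr_const; apply: eq_bigr => h hh; exact: tH.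
Qed.

End Young.

(** * The least weight of distinct symbols *)

Section Count.
Variables (T : eqType) (deg : T -> nat) (k N : nat) (s : 'I_N -> T).
Hypotheses (s_inj : injective s)
  (s_all : forall x, (deg x <= k)%N <-> exists i, s i = x).

(** Sum the truncated defects k + 1 - deg x: only the elements of degree at most k
    contribute, and an injective family meets each of them at most once, so its
    total defect is at most that of s. *)
Lemma degree_sum_ge (m : nat) (tau : 'I_m -> T) : injective tau ->
  (\sum_i deg (s i) + m * k.+1 <= \sum_i deg (tau i) + N * k.+1)%N.
Proof.
move=> tau_inj.
have le_k i : (deg (s i) <= k)%N by apply/s_all; exists i.
have defect (F : T -> nat) : (forall x, F x = k.+1 - deg x)%N ->
    (\sum_i F (tau i) <= \sum_i F (s i))%N.
  move=> FE; have -> : (\sum_i F (tau i) =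
      \sum_(x <- [seq tau i | i <- enum 'I_m] | (deg x <= k)%N) F x)%N.
    rewrite big_map big_enum_cond /= [LHS](bigID (fun i => deg (tau i) <= k)%N) /=.
    by rewrite [X in (_ + X)%N]big1 ?addn0 // => i; rewrite FE; lia.
  have -> : (\sum_i F (s i) = \sum_(x <- [seq s i | i <- enum 'I_N]) F x)%N.
    by rewrite big_map big_enum.
  rewrite -big_filter; apply: (uniq_sub_le_big leqnn (fun x y => leq_addr y x)).
  - by rewrite filter_uniq // map_inj_uniq // enum_uniq.
  - by rewrite map_inj_uniq // enum_uniq.
  - by move=> x; rewrite mem_filter => /andP[/s_all[i <-] _]; rewrite map_f ?mem_enum.
have := defect _ (fun x => erefl); rewrite (eq_bigr _ (fun i _ => erefl _)) => le_def.
have sE : (\sum_i (k.+1 - deg (s i)) + \sum_i deg (s i) = N * k.+1)%N.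
  have E i : (k.+1 - deg (s i) + deg (s i) = k.+1)%N by rewrite subnK // ltnW ?ltnS.
  by rewrite -big_split /= (eq_bigr _ (fun i _ => E i)) sum_nat_const card_ord.
have tauE : (m * k.+1 <= \sum_i (k.+1 - deg (tau i)) + \sum_i deg (tau i))%N.
  have -> : (m * k.+1 = \sum_(i < m) k.+1)%N by rewrite sum_nat_const card_ord.
  by rewrite -big_split; apply: leq_sum => i _ /=; lia.
by lia.
Qed.

Lemma degree_sum_le (x0 : T) : deg x0 = 0%N ->
  (\sum_i deg (s i) <= N.-1 * k)%N.
Proof.
move=> x00; have [i0 i0E] : exists i, s i = x0 by apply/s_all; rewrite x00.
rewrite (bigD1 i0) //= i0E x00 add0n.
apply: (@leq_trans (\sum_(i < N | i != i0) k)).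
  by apply: leq_sum => i _; apply/s_all; exists i.
by rewrite sum_nat_const cardC1 card_ord.
Qed.

End Count.

(** * Derivations of smooth functions *)

Section Derivations.
Variables (R : realType) (n : nat).
Local Notation A := (smoothFun R n).
Implicit Types (f g : A) (i j : 'I_n) (sigma : multiindex n).

Lemma smoothFun_smooth f : smooth f.
Proof. exact/smooth_predP/smooth_funP. Qed.

Lemma D_comm i j f : D i (D j f) = D j (D i f).
Proof.
have dv k (g : A) x : derivable g x (delta_mx 0 k).
  exact/smooth_derivable/smoothFun_smooth.
apply: val_inj; apply: (@derive_comm R 'rV[R]_n).
- exact: dv.
- exact: dv.
- exact: (dv _ (D j f)).
- exact: (dv _ (D i f)).
- exact/smooth_continuous/(smoothFun_smooth (D i (D j f))).
- exact/smooth_continuous/(smoothFun_smooth (D j (D i f))).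
Qed.

Lemma D_mul i f g : D i (f * g) = D i f * g + f * D i g.
Proof. by apply: val_inj => /=; rewrite -partialM; [|exact: smoothFun_smooth..]. Qed.

HB.instance Definition _ i :=
  GRing.isLinear.Build R A A *:%R (D i) (@D_linear R n i).

HB.instance Definition _ sigma :=
  GRing.isLinear.Build R A A *:%R (Dm sigma) (@Dm_linear R n sigma).

Lemma D_one i : D i (1 : A) = 0.
Proof.
have := D_mul i 1 1; rewrite !mulr1 mul1r => /(congr1 (fun g => g - D i 1)).
by rewrite subrr addrK => <-.
Qed.

Lemma D_prod i (m : nat) (F : 'I_m -> A) :
  D i (\prod_j F j) = \sum_j D i (F j) * \prod_(k | k != j) F k.
Proof.
elim: m F => [|m IH] F; first by rewrite !big_ord0 D_one.
rewrite big_ord_recl D_mul IH [RHS]big_ord_recl mulr_sumr; congr (_ + _).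
  by rewrite [in RHS]big_mkcond big_ord_recl /= mul1r.
apply: eq_bigr => j _; rewrite mulrCA; congr (_ * _).
by rewrite [RHS]big_mkcond big_ord_recl /= [in LHS]big_mkcond; congr (_ * _).
Qed.

Definition mincr i sigma : multiindex n := [ffun j => sigma j + (j == i)]%N.

Lemma mnorm_mincr i sigma : mnorm (mincr i sigma) = (mnorm sigma).+1.
Proof.
rewrite /mnorm (eq_bigr (fun j => sigma j + (j == i))%N) => [|j _]; last by rewrite ffunE.
rewrite big_split /= [X in (_ + X)%N](bigD1 i) //= eqxx.
by rewrite [X in (_ + (_ + X))%N]big1 ?addn0 ?addn1 // => j /negbTE ->.
Qed.

(** [Dm] differentiates in a fixed order of the variables; the new derivative is
    commuted inwards to the place of its own variable. *)
Lemma D_Dm i sigma f : D i (Dm sigma f) = Dm (mincr i sigma) f.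
Proof.
rewrite /Dm; have : i \in enum 'I_n by rewrite mem_enum.
have iterC j m g : D i (iter m (D j) g) = iter m (D j) (D i g).
  by elim: m => //= m <-; exact: D_comm.
elim: (enum 'I_n) (enum_uniq 'I_n) => //= j r IH /andP[jr ur].
rewrite inE; move: jr; have [<- ir _|ij _ /= ir] := eqVneq i j.
  rewrite ffunE eqxx addn1 /=; congr (D i (iter _ _ _)).
  elim: r ir {IH ur} => //= k r IH; rewrite inE negb_or => /andP[ik ir].
  by rewrite ffunE (eq_sym k) (negbTE ik) addn0 IH.
by rewrite iterC IH // ffunE (eq_sym j) (negbTE ij) addn0.
Qed.

End Derivations.

(** * Homogeneous multidifferential operators *)

Section JetForms.
Variables (R : realType) (n : nat).
Local Notation A := (smoothFun R n).

(** Multilinear differential operators with constant coefficients, homogeneous of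
    weight w. Integer coefficients suffice for Wronskians, so closure under sums
    and opposites is enough. *)
Inductive jet_form (m w : nat) : (('I_m -> A) -> A) -> Prop :=
| jet_mono (tau : 'I_m -> multiindex n) of (\sum_j mnorm (tau j) = w)%N :
    jet_form w (fun a => \prod_j Dm (tau j) (a j))
| jet_zero : jet_form w (fun=> 0)
| jet_add Phi Psi of jet_form w Phi & jet_form w Psi :
    jet_form w (fun a => Phi a + Psi a)
| jet_opp Phi of jet_form w Phi : jet_form w (fun a => - Phi a).

Lemma jet_form_ext m w (Phi Psi : ('I_m -> A) -> A) :
  jet_form w Phi -> Phi =1 Psi -> jet_form w Psi.
Proof. by move=> + /funext <-. Qed.

Lemma jet_form_sum m w (I : Type) (r : seq I) (P : pred I)
    (Phi : I -> ('I_m -> A) -> A) :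
  (forall i, P i -> jet_form w (Phi i)) ->
  jet_form w (fun a => \sum_(i <- r | P i) Phi i a).
Proof.
move=> PhiP; elim: r => [|i r IH].
  by apply: jet_form_ext (jet_zero _ _) _ => a; rewrite big_nil.
have [Pi|nPi] := boolP (P i).
  by apply: jet_form_ext (jet_add (PhiP _ Pi) IH) _ => a; rewrite big_cons Pi.
by apply: jet_form_ext IH _ => a; rewrite big_cons (negbTE nPi).
Qed.

Lemma jet_form_sign m w (b : bool) (Phi : ('I_m -> A) -> A) :
  jet_form w Phi -> jet_form w (fun a => (-1) ^+ b * Phi a).
Proof.
case: b => PhiP.
  by apply: jet_form_ext (jet_opp PhiP) _ => a; rewrite mulN1r.
by apply: jet_form_ext PhiP _ => a; rewrite mul1r.
Qed.

Lemma jet_form_D m w i (Phi : ('I_m -> A) -> A) :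
  jet_form w Phi -> jet_form w.+1 (fun a => D i (Phi a)).
Proof.
elim=> {Phi} [tau tauw||Phi Psi _ IH _ IH'|Phi _ IH].
- suff H j : jet_form w.+1 (fun a => D i (Dm (tau j) (a j)) *
      \prod_(k | k != j) Dm (tau k) (a k)).
    by apply: jet_form_ext (jet_form_sum _ (fun j _ => H j)) _ => a; rewrite D_prod.
  pose tau' k := if k == j then mincr i (tau k) else tau k.
  apply: jet_form_ext (@jet_mono _ _ tau' _) _.
    rewrite -tauw (bigD1 j) //= [in RHS](bigD1 j) //= /tau' eqxx mnorm_mincr addSn.
    by congr (_ + _).+1; apply: eq_bigr => k /negbTE ->.
  move=> a; rewrite (bigD1 j) //= /tau' eqxx D_Dm; congr (_ * _).
  by apply: eq_bigr => k /negbTE ->.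
- by apply: jet_form_ext (jet_zero _ _) _ => a; rewrite linear0.
- by apply: jet_form_ext (jet_add IH IH') _ => a; rewrite linearD.
- by apply: jet_form_ext (jet_opp IH) _ => a; rewrite linearN.
Qed.

Lemma jet_form_Dm m w sigma (Phi : ('I_m -> A) -> A) :
  jet_form w Phi -> jet_form (mnorm sigma + w) (fun a => Dm sigma (Phi a)).
Proof.
move=> PhiP; rewrite /mnorm /Dm -big_enum /=.
elim: (enum 'I_n) => [|i r IH]; first by rewrite big_nil.
rewrite big_cons -addnA /=.
elim: (sigma i) => //= k IHk; exact: jet_form_D.
Qed.

Lemma jet_formM l k w v (Phi : ('I_l -> A) -> A) (Psi : ('I_k -> A) -> A) :
  jet_form w Phi -> jet_form v Psi ->
  jet_form (w + v) (fun a : 'I_(l + k) -> A =>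
    Phi (fun j => a (lshift k j)) * Psi (fun j => a (rshift l j))).
Proof.
move=> PhiP PsiP.
elim: PhiP => {Phi} [tau tauw||Phi Phi' _ IH _ IH'|Phi _ IH].
- elim: PsiP => {Psi} [rho rhov||Psi Psi' _ IH _ IH'|Psi _ IH].
  + pose kappa i := match fintype.split i with inl j => tau j | inr j => rho j end.
    have kl j : kappa (lshift k j) = tau j by rewrite /kappa (unsplitK (inl j)).
    have kr j : kappa (rshift l j) = rho j by rewrite /kappa (unsplitK (inr j)).
    apply: jet_form_ext (@jet_mono _ _ kappa _) _.
      rewrite -tauw -rhov big_split_ord /=.
      by congr (_ + _)%N; apply: eq_bigr => j _; rewrite ?kl ?kr.
    move=> a; rewrite big_split_ord /=.
    by congr (_ * _); apply: eq_bigr => j _; rewrite ?kl ?kr.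
  + by apply: jet_form_ext (jet_zero _ _) _ => a; rewrite mulr0.
  + by apply: jet_form_ext (jet_add IH IH') _ => a; rewrite mulrDr.
  + by apply: jet_form_ext (jet_opp IH) _ => a; rewrite mulrN.
- by apply: jet_form_ext (jet_zero _ _) _ => a; rewrite mul0r.
- by apply: jet_form_ext (jet_add IH IH') _ => a; rewrite mulrDl.
- by apply: jet_form_ext (jet_opp IH) _ => a; rewrite mulNr.
Qed.

Lemma jet_form_cast l m w (e : l = m) (Phi : ('I_l -> A) -> A) :
  jet_form w Phi -> jet_form w (fun a : 'I_m -> A => Phi (fun j => a (cast_ord e j))).
Proof.
case: m / e => PhiP; apply: jet_form_ext PhiP _ => a; congr (Phi _).
by apply/funext => j; rewrite cast_ord_id.
Qed.

Lemma sum_mnorm_perm N (s : 'I_N -> multiindex n) (p : 'S_N) :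
  (\sum_j mnorm (s (p j)) = \sum_j mnorm (s j))%N.
Proof. by rewrite [RHS](reindex_inj (@perm_inj _ p)). Qed.

Lemma wronskianE N (s : 'I_N -> multiindex n) (a : 'I_N -> A) :
  wronskian s a = \sum_(p : 'S_N) (-1) ^+ p * \prod_j Dm (s (p j)) (a j).
Proof.
rewrite /wronskian -det_tr; apply: eq_bigr => p _; congr (_ * _).
by apply: eq_bigr => j _; rewrite !mxE.
Qed.

Lemma jet_form_wronskian N (s : 'I_N -> multiindex n) :
  jet_form (\sum_j mnorm (s j))%N (@wronskian R n N s).
Proof.
have H (p : 'S_N) : jet_form (\sum_j mnorm (s j))%N
    (fun a : 'I_N -> A => (-1) ^+ p * \prod_j Dm (s (p j)) (a j)).
  apply: jet_form_sign; apply: (jet_mono (tau := s \o p)); exact: sum_mnorm_perm.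
by apply: jet_form_ext (jet_form_sum _ (fun p _ => H p)) _ => a; rewrite wronskianE.
Qed.

Definition alternation m (Phi : ('I_m -> A) -> A) (a : 'I_m -> A) : A :=
  \sum_(s : 'S_m) (-1) ^+ s * Phi (a \o s).

(** The alternation of a monomial with symbols tau_j is the determinant of the
    Dm (tau i) (a j). The weight w is too small for the tau_i to be distinct, so
    this matrix has two equal rows. *)
Lemma alternation_jet_form m w (Phi : ('I_m -> A) -> A) :
  (forall tau : 'I_m -> multiindex n, injective tau -> w < \sum_j mnorm (tau j))%N ->
  jet_form w Phi -> alternation Phi =1 fun=> 0.
Proof.
move=> wmin; elim=> {Phi} [tau tauw||Phi Psi _ IH _ IH'|Phi _ IH] a.
- have : ~ injective tau by move=> /wmin; rewrite tauw ltnn.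
  move=> /injectiveP/injectivePn[x [y neq_xy Exy]].
  transitivity (\det (\matrix_(i, j) Dm (tau i) (a j))).
    apply: eq_bigr => s _; congr (_ * _).
    by apply: eq_bigr => j _; rewrite mxE.
  by apply: (determinant_alternate neq_xy) => j; rewrite !mxE Exy.
- by rewrite /alternation big1 // => s _; rewrite mulr0.
- rewrite -[RHS]addr0 -{1}(IH a) -(IH' a) -big_split /=.
  by apply: eq_bigr => s _; rewrite mulrDr.
- rewrite -[RHS]oppr0 -(IH a) -sumrN.
  by apply: eq_bigr => s _; rewrite mulrN.
Qed.

End JetForms.

(** * Insertion of one Wronskian into another *)

Section Main.
Variables (R : realType) (n : nat).
Local Notation A := (smoothFun R n).

Section Insertion.
Variables (k l : nat) (s_out : 'I_k.+1 -> multiindex n)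
  (s_in : 'I_l -> multiindex n).

Definition inner_slot (j : 'I_l) : 'I_(k + l) := cast_ord (addnC l k) (lshift k j).
Definition outer_slot (j : 'I_k) : 'I_(k + l) := cast_ord (addnC l k) (rshift l j).

Definition slots (f : A) (b : 'I_k -> A) (i : 'I_k.+1) : A :=
  if unlift ord0 i is Some j then b j else f.

Definition insertion (a : 'I_(k + l) -> A) : A :=
  wronskian s_out (slots (wronskian s_in (a \o inner_slot)) (a \o outer_slot)).

Lemma wronskian_slots f b : wronskian s_out (slots f b) =
  \sum_(p : 'S_k.+1) (-1) ^+ p * (Dm (s_out (p ord0)) f *
     \prod_j Dm (s_out (p (lift ord0 j))) (b j)).
Proof.
rewrite wronskianE; apply: eq_bigr => p _; rewrite big_ord_recl /slots unlift_none.
by congr (_ * (_ * _)); apply: eq_bigr => j _; rewrite liftK.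
Qed.

(** In each term of the Leibniz expansion of the outer determinant exactly one
    derivative falls on the inner Wronskian and raises its weight; the others
    fall directly on arguments. *)
Lemma jet_form_insertion :
  jet_form (\sum_i mnorm (s_in i) + \sum_i mnorm (s_out i))%N insertion.
Proof.
have H (p : 'S_k.+1) : jet_form (\sum_i mnorm (s_in i) + \sum_i mnorm (s_out i))%N
    (fun a : 'I_(k + l) -> A => (-1) ^+ p *
     (Dm (s_out (p ord0)) (wronskian s_in (a \o inner_slot)) *
      \prod_j Dm (s_out (p (lift ord0 j))) ((a \o outer_slot) j))).
  apply: jet_form_sign; rewrite -(sum_mnorm_perm s_out p) big_ord_recl addnA.
  rewrite (addnC (\sum_i mnorm (s_in i))%N).
  have inner := jet_form_Dm (s_out (p ord0)) (@jet_form_wronskian R _ _ s_in).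
  have outer := @jet_mono R n k _ (fun j => s_out (p (lift ord0 j))) erefl.
  exact: (jet_form_cast (addnC l k) (jet_formM inner outer)).
apply: jet_form_ext (jet_form_sum _ (fun p _ => H p)) _ => a.
by rewrite /insertion wronskian_slots.
Qed.

Lemma wronskian_tperm N (s : 'I_N -> multiindex n) (a : 'I_N -> A) x y :
  x != y -> wronskian s (a \o tperm x y) = - wronskian s a.
Proof.
by move=> xy; rewrite (@wronskian_skew_multilinear R n _ s).2 odd_tperm xy mulN1r.
Qed.

Lemma slotsP (i : 'I_(k + l)) :
  (exists2 j, i = inner_slot j & (i < l)%N) \/
  (exists2 j, i = outer_slot j & (l <= i)%N).
Proof.
have [j Ej|j Ej] := splitP (cast_ord (addnC k l) i).
  by left; exists j; [exact: val_inj|].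
right; exists j; first exact: val_inj.
by have /= -> := Ej; rewrite leq_addr.
Qed.

Lemma inner_slot_inj : injective inner_slot.
Proof. by move=> i j /cast_ord_inj/lshift_inj. Qed.

Lemma outer_slot_inj : injective outer_slot.
Proof. by move=> i j /cast_ord_inj/rshift_inj. Qed.

Lemma slots_neq i j : inner_slot i != outer_slot j.
Proof. by rewrite -val_eqE /= ltn_eqF // ltn_addr. Qed.

(** A transposition of inner arguments changes the sign of the inner Wronskian, in
    which the outer one is linear; a transposition of outer arguments exchanges
    two columns of the outer determinant. *)
Lemma insertion_tperm (a : 'I_(k + l) -> A) x y : x != y -> same_block l x y ->
  insertion (a \o tperm x y) = - insertion a.
Proof.
rewrite /insertion /same_block.
have [[i -> xl]|[i -> xl]] := slotsP x; have [[j -> yl]|[j -> yl]] := slotsP y.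
- rewrite (inj_eq inner_slot_inj) => ij _.
  have -> : (a \o tperm (inner_slot i) (inner_slot j)) \o outer_slot = a \o outer_slot.
    by apply/funext => z /=; rewrite tpermD // slots_neq.
  have -> : (a \o tperm (inner_slot i) (inner_slot j)) \o inner_slot =
      (a \o inner_slot) \o tperm i j.
    by apply/funext => z /=; rewrite inj_tperm //; exact: inner_slot_inj.
  rewrite wronskian_tperm // !wronskian_slots -[RHS]sumrN.
  by apply: eq_bigr => p _; rewrite linearN mulNr mulrN.
- by move: xl yl => /= xl yl _; lia.
- by move: xl yl => /= xl yl _; lia.
- rewrite (inj_eq outer_slot_inj) => ij _.
  have -> : (a \o tperm (outer_slot i) (outer_slot j)) \o inner_slot = a \o inner_slot.
    by apply/funext => z /=; rewrite tpermD // eq_sym slots_neq.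
  rewrite -(@wronskian_tperm _ s_out _ (lift ord0 i) (lift ord0 j)); last first.
    by rewrite (inj_eq lift_inj).
  congr (wronskian s_out _); apply/funext => z; rewrite /slots /=.
  case: unliftP => [z' ->|->].
    rewrite -(inj_tperm _ _ _ outer_slot_inj) -(inj_tperm _ _ _ (@lift_inj _ ord0)).
    by rewrite !liftK.
  by rewrite tpermD ?unlift_none // eq_sym neq_lift.
Qed.

Lemma insertion_young (a : 'I_(k + l) -> A) (h : 'S_(k + l)) : h \in young l (k + l) ->
  insertion (a \o h) = (-1) ^+ h * insertion a.
Proof.
move=> hh; suff : [pred g : 'S_(k + l) | `[< forall a, insertion (a \o g) =
  (-1) ^+ g * insertion a >]] h by move=> /asboolP.
move: h hh; apply: young_ind => /=.
- apply/asboolP => b; rewrite odd_perm1 mul1r; congr insertion.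
  by apply/funext => i; rewrite /= perm1.
- move=> g h /asboolP Pg /asboolP Ph; apply/asboolP => b.
  have -> : b \o (g * h)%g = (b \o h) \o g by apply/funext => i; rewrite /= permM.
  by rewrite Pg Ph mulrA odd_permM signr_addb.
- move=> p q pq; apply/asboolP => b; rewrite odd_tperm.
  have [->|neq] := eqVneq p q; last by rewrite insertion_tperm // mulN1r.
  by rewrite tperm1 mul1r; congr insertion; apply/funext => i; rewrite /= perm1.
Qed.

Lemma bracket_actionE (a : 'I_(k + l) -> A) :
  bracket_action (wronskian s_out) (wronskian s_in) a =
  \sum_(s : 'S_(k + l) | unshuffle l s) (-1) ^+ s * insertion (a \o s).
Proof. by []. Qed.

Lemma alternation_insertion (a : 'I_(k + l) -> A) :
  alternation insertion a =
  bracket_action (wronskian s_out) (wronskian s_in) a *+ #|young l (k + l)|.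
Proof.
rewrite bracket_actionE.
apply: (sum_unshuffle (t := fun s => (-1) ^+ s * insertion (a \o s))) => h s hh.
have -> : a \o (h * s)%g = (a \o s) \o h by apply/funext => i; rewrite /= permM.
rewrite (insertion_young (a \o s) hh) odd_permM signr_addb mulrACA -mulrA.
by rewrite signrMK.
Qed.

End Insertion.

Lemma smoothFun_mulrn_eq0 (f : A) m : (0 < m)%N -> f *+ m = 0 -> f = 0.
Proof.
move=> m0 /eqP; rewrite -scaler_nat scaler_eq0 pnatr_eq0 -leqn0 leqNgt m0.
by move=> /eqP.
Qed.

(** Both numbers of arguments must exceed 1: with N_in = 1 the inner bracket is
    the identity, and the action gives N_out times the outer bracket;
    with N_out = 1 the outer one is the identity and the action returns the
    inner bracket. *)
Lemma bracket_action_wronskian_eq0 kin kout N_out N_in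
    (s_out : 'I_N_out -> multiindex n) (s_in : 'I_N_in -> multiindex n) a :
  (1 < N_out)%N -> (1 < N_in)%N ->
  graded_enum kin s_in -> graded_enum kout s_out ->
  bracket_action (@wronskian R n _ s_out) (@wronskian R n _ s_in) a = 0.
Proof.
case: N_out s_out a => // k s_out a k_gt0 l_gt1 [in_inj in_all _] [out_inj out_all _].
apply: (@smoothFun_mulrn_eq0 _ #|young N_in (k + N_in)|); first exact: cardG_gt0.
rewrite -(alternation_insertion s_out s_in a).
apply: alternation_jet_form (jet_form_insertion s_out s_in) a => tau tau_inj.
have mnorm0 : mnorm ([ffun=> 0%N] : multiindex n) = 0%N.
  by rewrite /mnorm big1 // => i _; rewrite ffunE.
have in_ge := degree_sum_ge in_inj in_all tau_inj.
have out_ge := degree_sum_ge out_inj out_all tau_inj.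
have in_le := degree_sum_le in_all mnorm0.
have out_le := degree_sum_le out_all mnorm0.
(* Whichever order is the larger, its own multi-indices bound the weight from
   below and the zero multi-index of the other family leaves the gap. *)
have [le_k|lt_k] := leqP kin kout; nia.
Qed.

End Main.

Theorem theorem17 (R : realType) (n kin kout : nat)
  (n_gt0 : (0 < n)%N) (kin_gt0 : (0 < kin)%N) (kout_gt0 : (0 < kout)%N)
  (s_in : 'I_('C(n + kin, n)) -> multiindex n)
  (s_out : 'I_('C(n + kout, n)) -> multiindex n)
  (s_inP : graded_enum kin s_in) (s_outP : graded_enum kout s_out)
  (a : 'I_('C(n + kout, n) + 'C(n + kin, n)).-1 -> smoothFun R n) :
  bracket_action (@wronskian R n _ s_out) (@wronskian R n _ s_in) a = 0%R.
Proof.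
have bin_gt1 k : (0 < k)%N -> (1 < 'C(n + k, n))%N.
  move=> k0; apply: leq_trans (_ : 'C(n.+1, n) <= _)%N; first by rewrite binSn.
  by apply: leq_bin2l; rewrite -addn1 leq_add2l.
exact: bracket_action_wronskian_eq0 (bin_gt1 _ kout_gt0) (bin_gt1 _ kin_gt0) s_inP s_outP.
Qed.
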